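(* Let $\mathcal{G}$ be a groupoid, let $G$ be a group with identity $1_G$, and let $\omega:G\to\mathrm{Aut}(\mathcal{G})$ be a homomorphism of groups. Then the following assertions are equivalent: (i) the identity map between $\mathcal{G}\times G$ and $\mathcal{G}\times_\omega G$ is a homomorphism of groupoids, and thus an isomorphism; (ii) $\omega$ is trivial; (iii) $\mathcal{G}_0\times G$ is normal in $\mathcal{G}\times_\omega G$.
   Context: A groupoid $\mathcal{G}$ is a small category in which every morphism is invertible; it is identified with its set of morphisms, and each object $e$ is identified with its identity morphism, so the set of objects $\mathcal{G}_0$ is a subset of $\mathcal{G}$. For a morphism $g:e\to f$ put $d(g)=e$ (domain) and $r(g)=f$ (range). The composite $gh$ exists, written $\exists gh$, if and only if $d(g)=r(h)$. A nonempty subset $\mathcal{H}\subseteq\mathcal{G}$ is a subgroupoid if for all $g,h\in\mathcal{H}$, $g^{-1}\in\mathcal{H}$, and $gh\in\mathcal{H}$ whenever $\exists gh$. It is wide if $\mathcal{G}_0\subseteq\mathcal{H}$. It is normal if it is wide and $g^{-1}\mathcal{H}g\subseteq\mathcal{H}$ for all $g\in\mathcal{G}$, where $g^{-1}\mathcal{H}g=\{g^{-1}hg\mid h\in\mathcal{H},\ r(h)=d(h)=r(g)\}$. The direct product $\mathcal{G}\times G$ (the group $G$ being viewed as a groupoid with one object) is the set of pairs with componentwise partial product: $\exists (x,g)(z,h)$ if and only if $\exists xz$, and then $(x,g)(z,h)=(xz,gh)$. The semidirect product $\mathcal{G}\times_\omega G$ is the set $\mathcal{G}\times G$ with the partial product: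 $\exists (x,g)(z,h)$ if and only if $d(x)=r(\omega_g(z))$, and in this case $(x,g)(z,h)=(x\,\omega_g(z),gh)$. It is a groupoid with $d(x,a)=(\omega_{a^{-1}}(d(x)),1_G)$, $r(x,a)=(r(x),1_G)$ and $(x,a)^{-1}=(\omega_{a^{-1}}(x^{-1}),a^{-1})$. $\omega$ is trivial if $\omega_g$ is the identity automorphism of $\mathcal{G}$ for all $g\in G$.
   Formalization: 𝒢 is assumed nonempty, and (iii) also requires the inclusion of the direct product 𝒢₀×G into 𝒢×_ωG to be a homomorphism; with the bare set of pairs, (iii)⇒(ii) fails (two objects with only identities, swapped by Z/2). *)

(* Defs.v *)
From HB Require Import structures.
From mathcomp Require Import all_boot.
From mathcomp Require Import boolp classical_sets.

Set Implicit Arguments.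
Unset Strict Implicit.
Unset Printing Implicit Defensive.

Local Open Scope classical_set_scope.
Local Open Scope group_scope.

(* A small category with invertible morphisms, presented by its set of
   morphisms; an object is identified with its identity morphism, so [gdom]
   and [grng] return identities.  The composite [gcomp g h] exists iff
   [gdom g = grng h]; [gcomp] is a total function whose values outside that
   domain are junk, and nothing below looks at them. *)
Record groupoid := Groupoid {
  mor :> Type;
  gdom : mor -> mor;
  grng : mor -> mor;
  gcomp : mor -> mor -> mor;
  ginv : mor -> mor;
  gdomD : forall g, gdom (gdom g) = gdom g;
  grngD : forall g, grng (gdom g) = gdom g;
  gdomR : forall g, gdom (grng g) = grng g;
  grngR : forall g, grng (grng g) = grng g;
  gdom_comp : forall g h, gdom g = grng h -> gdom (gcomp g h) = gdom h;
  grng_comp : forall g h, gdom g = grng h -> grng (gcomp g h) = grng g;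
  gcompA : forall f g h, gdom f = grng g -> gdom g = grng h ->
    gcomp f (gcomp g h) = gcomp (gcomp f g) h;
  gcomp_dom : forall g, gcomp g (gdom g) = g;
  gcomp_rng : forall g, gcomp (grng g) g = g;
  gdom_inv : forall g, gdom (ginv g) = grng g;
  grng_inv : forall g, grng (ginv g) = gdom g;
  gcompVg : forall g, gcomp (ginv g) g = gdom g;
  gcompgV : forall g, gcomp g (ginv g) = grng g }.

Arguments gdom {X} _ : rename.
Arguments grng {X} _ : rename.
Arguments gcomp {X} _ _ : rename.
Arguments ginv {X} _ : rename.

Definition composable (X : groupoid) (g h : X) : Prop := gdom g = grng h.

Definition objects (X : groupoid) : set X := [set e | gdom e = e].
Arguments objects : clear implicits.

Section Morphisms.
Variables X Y : groupoid.

Definition groupoid_hom (f : X -> Y) : Prop :=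
  forall g h, composable g h ->
    composable (f g) (f h) /\ f (gcomp g h) = gcomp (f g) (f h).

End Morphisms.

Definition groupoid_iso (X Y : groupoid) (f : X -> Y) : Prop :=
  groupoid_hom f /\
  exists f' : Y -> X, [/\ groupoid_hom f', cancel f f' & cancel f' f].

Section Subgroupoids.
Variable X : groupoid.
Implicit Type H : set X.

Definition subgroupoid H : Prop :=
  H !=set0 /\
  forall g h, H g -> H h ->
    H (ginv g) /\ (composable g h -> H (gcomp g h)).

Definition wide H : Prop := subgroupoid H /\ objects X `<=` H.

Definition gconj H (g : X) : set X :=
  [set y | exists h : X, [/\ H h, grng h = grng g, gdom h = grng g
                           & y = gcomp (gcomp (ginv g) h) g]].

Definition normal H : Prop := wide H /\ forall g, gconj H g `<=` H.

End Subgroupoids.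

(* A groupoid [K] lying inside [X] through the inclusion [i] is a normal
   subgroupoid of [X]: its own partial product is the one of [X], and its
   set of morphisms is normal.  The second clause of [normal_in] is not
   redundant: for a swap action on two objects, the set of all pairs
   (object, group element) is the whole semidirect product, hence a normal
   set, but its product is not the direct one. *)
Definition normal_in (K X : groupoid) (i : K -> X) : Prop :=
  [/\ injective i, groupoid_hom i & normal (range i)].

Section BasicTheory.
Lemma gdom_id (X : groupoid) (e : X) : objects X e -> grng e = e.
Proof. by move=> eE; rewrite -[in LHS]eE grngD. Qed.

Lemma idem_object (X : groupoid) (e : X) : composable e e -> gcomp e e = e -> gdom e = e.
Proof.
move=> ce ee; have := gcompVg e; rewrite -{2}ee gcompA ?gdom_inv //.
by rewrite gcompVg; move: (ce); rewrite /composable => ->; rewrite gcomp_rng.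
Qed.

Variables (X Y : groupoid) (f : X -> Y).
Hypothesis fH : groupoid_hom f.

Lemma hom_object (e : X) : gdom e = e -> gdom (f e) = f e.
Proof.
move=> eE; have c : composable e e by rewrite /composable gdom_id.
have [cf fe] := fH c; apply: (idem_object cf).
by rewrite -fe -{2}eE gcomp_dom.
Qed.

Lemma hom_dom (g : X) : f (gdom g) = gdom (f g).
Proof.
have c : composable g (gdom g) by rewrite /composable grngD.
have [-> _] := fH c.
by rewrite gdom_id //; apply/hom_object/gdomD.
Qed.

Lemma hom_rng (g : X) : f (grng g) = grng (f g).
Proof.
have c : composable (grng g) g by rewrite /composable gdomR.
have [<- _] := fH c.
by rewrite hom_object // gdomR.
Qed.

Lemma hom_comp (g h : X) :
  gdom g = grng h -> f (gcomp g h) = gcomp (f g) (f h).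
Proof. by move=> /fH[]. Qed.

End BasicTheory.

Section OneObject.
Variable G : groupType.

Definition one_object : groupoid.
Proof.
refine (@Groupoid G (fun=> 1) (fun=> 1) (fun a b => a * b) (fun a => a^-1)
          _ _ _ _ _ _ _ _ _ _ _ _ _) => //.
- by move=> *; rewrite mulgA.
- by move=> g; rewrite mulg1.
- by move=> g; rewrite mul1g.
- by move=> g; rewrite mulVg.
- by move=> g; rewrite mulgV.
Defined.

End OneObject.

Section ObjectGroupoid.
Variable X : groupoid.

(* The subgroupoid of identities: the only composites are e e = e. *)
Definition object_groupoid : groupoid.
Proof.
by refine (@Groupoid {e : X | objects X e} id id (fun e _ => e) id
          _ _ _ _ _ _ _ _ _ _ _ _ _).
Defined.

End ObjectGroupoid.

Section DirectProduct.
Variables X Y : groupoid.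

Definition gprod : groupoid.
Proof.
refine (@Groupoid (X * Y)%type
  (fun p => (gdom p.1, gdom p.2)) (fun p => (grng p.1, grng p.2))
  (fun p q => (gcomp p.1 q.1, gcomp p.2 q.2))
  (fun p => (ginv p.1, ginv p.2)) _ _ _ _ _ _ _ _ _ _ _ _ _) => /=.
- by move=> g; rewrite !gdomD.
- by move=> g; rewrite !grngD.
- by move=> g; rewrite !gdomR.
- by move=> g; rewrite !grngR.
- by move=> g h [? ?]; rewrite !gdom_comp.
- by move=> g h [? ?]; rewrite !grng_comp.
- by move=> f g h [? ?] [? ?]; rewrite !gcompA.
- by move=> [a b]; rewrite !gcomp_dom.
- by move=> [a b]; rewrite !gcomp_rng.
- by move=> g; rewrite !gdom_inv.
- by move=> g; rewrite !grng_inv.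
- by move=> g; rewrite !gcompVg.
- by move=> g; rewrite !gcompgV.
Defined.

End DirectProduct.

Definition dprod (X : groupoid) (G : groupType) : groupoid :=
  gprod X (one_object G).

Section Aut.
Variable X : groupoid.

Record Aut := MkAut { aut_fun :> X -> X; aut_iso : groupoid_iso aut_fun }.

Implicit Types s t : Aut.

Lemma aut_hom s : groupoid_hom s. Proof. by case: (aut_iso s). Qed.

Lemma aut_ext s t : s =1 t -> s = t.
Proof.
case: s t => [s sP] [t tP] /= /funext st; case: _ / st in tP *.
by rewrite (Prop_irrelevance sP tP).
Qed.

Lemma aut_one_subproof : @groupoid_iso X X id.
Proof. by split=> [g h ? //|]; exists id; split. Qed.

Lemma hom_compose (Y Z W : groupoid) (f : Z -> W) (g : Y -> Z) :
  groupoid_hom f -> groupoid_hom g -> groupoid_hom (f \o g).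
Proof. by move=> fH gH x y /gH[c e] /=; rewrite e; apply: fH. Qed.

Lemma aut_mul_subproof s t : groupoid_iso (s \o t).
Proof.
case: s t => [s [sH [s' [s'H sK s'K]]]] [t [tH [t' [t'H tK t'K]]]] /=.
split; first exact: hom_compose.
exists (t' \o s'); split; first exact: hom_compose.
  exact: can_comp.
exact: can_comp.
Qed.

Definition aut_one := MkAut aut_one_subproof.
Definition aut_mul s t := MkAut (aut_mul_subproof s t).

Lemma aut_inv_ex s : exists t : Aut, cancel s t /\ cancel t s.
Proof.
case: s => [s [sH [s' [s'H sK s'K]]]].
have s'I : groupoid_iso s' by split=> //; exists s; split.
by exists (MkAut s'I).
Qed.

Definition aut_inv s := projT1 (cid (aut_inv_ex s)).

Lemma aut_invK s : cancel s (aut_inv s) /\ cancel (aut_inv s) s.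
Proof. exact: (projT2 (cid (aut_inv_ex s))). Qed.

Lemma aut_mulA : associative aut_mul. Proof. by move=> *; apply: aut_ext. Qed.
Lemma aut_mul1g : left_id aut_one aut_mul.
Proof. by move=> *; apply: aut_ext. Qed.
Lemma aut_mulg1 : right_id aut_one aut_mul.
Proof. by move=> *; apply: aut_ext. Qed.
Lemma aut_mulVg : left_inverse aut_one aut_inv aut_mul.
Proof. by move=> s; apply: aut_ext => x /=; apply: (aut_invK s).1. Qed.
Lemma aut_mulgV : right_inverse aut_one aut_inv aut_mul.
Proof. by move=> s; apply: aut_ext => x /=; apply: (aut_invK s).2. Qed.

HB.instance Definition _ := gen_eqMixin Aut.
HB.instance Definition _ := gen_choiceMixin Aut.
HB.instance Definition _ :=
  isGroup.Build Aut aut_mulA aut_mul1g aut_mulg1 aut_mulVg aut_mulgV.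

End Aut.

Section Semidirect.
Variables (X : groupoid) (G : groupType) (w : {multiplicative G -> Aut X}).

Lemma act_mul (a b : G) (x : X) : w (a * b) x = w a (w b x).
Proof. by rewrite gmulfM. Qed.

Lemma act_one (x : X) : w 1 x = x.
Proof.
have [K _] := aut_invK (w 1); rewrite -[LHS]K.
by rewrite -act_mul mulg1 K.
Qed.

Lemma actK (a : G) (x : X) : w a^-1 (w a x) = x.
Proof. by rewrite -act_mul mulVg act_one. Qed.

Lemma actVK (a : G) (x : X) : w a (w a^-1 x) = x.
Proof. by rewrite -act_mul mulgV act_one. Qed.

Definition sdprod : groupoid.
Proof.
refine (@Groupoid (X * G)%type
  (fun p => (w p.2^-1 (gdom p.1), 1)) (fun p => (grng p.1, 1))
  (fun p q => (gcomp p.1 (w p.2 q.1), p.2 * q.2))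
  (fun p => (w p.2^-1 (ginv p.1), p.2^-1)) _ _ _ _ _ _ _ _ _ _ _ _ _) => /=.
- by move=> [x a] /=; rewrite invg1 act_one -(hom_dom (aut_hom _)) gdomD.
- by move=> [x a] /=; rewrite -(hom_rng (aut_hom _)) grngD.
- by move=> [x a] /=; rewrite invg1 act_one gdomR.
- by move=> [x a] /=; rewrite grngR.
- move=> [x a] [z b] /= [e].
  have c : gdom x = grng (w a z) by rewrite -(hom_rng (aut_hom _)) -e actVK.
  by rewrite gdom_comp // invgM act_mul -(hom_dom (aut_hom _)) actK.
- move=> [x a] [z b] /= [e].
  have c : gdom x = grng (w a z) by rewrite -(hom_rng (aut_hom _)) -e actVK.
  by rewrite grng_comp.
- move=> [x a] [y b] [z c] /= [e1] [e2].
  have c1 : gdom x = grng (w a y) by rewrite -(hom_rng (aut_hom _)) -e1 actVK.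
  have c2 : gdom y = grng (w b z) by rewrite -(hom_rng (aut_hom _)) -e2 actVK.
  rewrite (hom_comp (aut_hom _)) // gcompA // ?mulgA ?act_mul //.
  by rewrite -(hom_dom (aut_hom _)) -(hom_rng (aut_hom _)) c2.
- by move=> [x a] /=; rewrite actVK gcomp_dom mulg1.
- by move=> [x a] /=; rewrite act_one gcomp_rng mul1g.
- by move=> [x a] /=; rewrite -(hom_dom (aut_hom _)) invgK actVK gdom_inv.
- by move=> [x a] /=; rewrite -(hom_rng (aut_hom _)) grng_inv.
- move=> [x a] /=; rewrite -(hom_comp (aut_hom _)) ?gdom_inv //.
  by rewrite gcompVg mulVg.
- by move=> [x a] /=; rewrite actVK gcompgV mulgV.
Defined.

Lemma sdprod_composableP (x z : X) (a b : G) :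
  @composable sdprod (x, a) (z, b) <-> gdom x = grng (w a z).
Proof.
rewrite /composable /= -(hom_rng (aut_hom _)); split=> [[<-]|->].
  by rewrite actVK.
by rewrite actK.
Qed.

Definition trivial_action : Prop := forall g : G, w g = aut_one X.

Definition objects_incl (p : dprod (object_groupoid X) G) : sdprod :=
  (sval p.1, p.2).

End Semidirect.

(* Main.v *)
Require Import Defs.
From mathcomp Require Import all_boot.
From mathcomp Require Import boolp classical_sets.

Set Implicit Arguments.
Unset Strict Implicit.
Unset Printing Implicit Defensive.

(** If the identity is a homomorphism, comparing the two products of [(r(x), a)]
    and [(x, 1)] gives [x = w_a(x)].  If [G_0 x G] is a normal subgroupoid, the
    products [(e, a)(e, 1)] show that [w] fixes every object [e], and then the
    conjugate of [(r(x), a)] by [(x, 1)] is [(x^-1 w_a(x), a)], so that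
    [x^-1 w_a(x)] is an object, that is [w_a(x) = x]. *)

Lemma objects_rng (X : groupoid) (x : X) : objects X (grng x).
Proof. exact: gdomR. Qed.

Lemma objects_dom (X : groupoid) (x : X) : objects X (gdom x).
Proof. exact: gdomD. Qed.

Lemma objects_inv (X : groupoid) (e : X) : objects X e -> objects X (ginv e).
Proof.
move=> eO; suff -> : ginv e = e by [].
by rewrite -[LHS]gcomp_dom gdom_inv (gdom_id eO) gcompVg eO.
Qed.

(** An object equals its own range, so [x^-1 y = r(x^-1) = d(x)]; composing with [x] on the left
    gives [y = x]. *)
Lemma eq_of_inv_comp_object (X : groupoid) (x y : X) :
  grng y = grng x -> objects X (gcomp (ginv x) y) -> y = x.
Proof.
move=> rxy ob.
have c : gdom (ginv x) = grng y by rewrite gdom_inv.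
have e : gcomp (ginv x) y = gdom x.
  by rewrite -(gdom_id ob) grng_comp // grng_inv.
have := gcomp_dom x.
by rewrite -e gcompA ?grng_inv // gcompgV -rxy gcomp_rng.
Qed.

Section Semidirect.
Variables (X : groupoid) (G : groupType) (w : {multiplicative G -> Aut X}).

Lemma trivial_actionP : trivial_action w <-> forall g x, w g x = x.
Proof.
by split=> [t g x|t g]; [rewrite t | apply: aut_ext => x; apply: t].
Qed.

Lemma hom_identityP :
  groupoid_hom ((fun p => p) : dprod X G -> sdprod w) <-> trivial_action w.
Proof.
rewrite trivial_actionP; split=> [idH a x|t [x a] [z b] [c]].
  have c : @composable (dprod X G) (grng x, a) (x, 1%g).
    by rewrite /composable /= gdomR.
  have [/sdprod_composableP r [e]] := idH _ _ c.
  (* Composability in the semidirect product gives [r(x) = r(w_a(x))], so the left factor [r(x)] is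
     absorbed on both sides of [e]. *)
  rewrite gdomR in r.
  by rewrite gcomp_rng r gcomp_rng in e.
split; first by apply/sdprod_composableP; rewrite t.
by rewrite /= t.
Qed.

Lemma hom_identity_inv :
  trivial_action w -> groupoid_hom ((fun p => p) : sdprod w -> dprod X G).
Proof.
move=> /trivial_actionP t [x a] [z b] /sdprod_composableP; rewrite t => c.
by split; rewrite /composable /= ?c ?t.
Qed.

(** Reduces the closure conditions in [normal] to conditions on first components, inside [X]. *)
Lemma range_objects_inclP (p : sdprod w) :
  range (@objects_incl X G w) p <-> objects X p.1.
Proof.
split=> [[[[e eO] a] _ <-] //|]; case: p => x a /= xO.
by exists (exist _ x xO, a).
Qed.

Lemma objects_incl_inj : injective (@objects_incl X G w).
Proof.
move=> [[e eO] a] [[f fO] b] [/= ef ab].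
by subst f b; rewrite (Prop_irrelevance eO fO).
Qed.

Lemma normal_in_of_trivial (X_nonempty : inhabited X) :
  trivial_action w -> normal_in (@objects_incl X G w).
Proof.
move=> /trivial_actionP t; split; first exact: objects_incl_inj.
  move=> [[e eO] a] [[f fO] b] [ef].
  subst f; split.
    by apply/sdprod_composableP; rewrite t /= (gdom_id eO).
  by congr pair; rewrite /= t -[in X in gcomp _ X]eO gcomp_dom.
split; first split; first split.
- case: X_nonempty => x.
  by exists (gdom x, 1%g); apply/range_objects_inclP/objects_dom.
- move=> [x a] [z b] /range_objects_inclP /= xO /range_objects_inclP /= zO.
  split=> [|/sdprod_composableP].
    apply/range_objects_inclP; rewrite /= t.
    exact: objects_inv.
  rewrite t => c; apply/range_objects_inclP => /=.
  (* Two composable objects coincide. *)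
  have xz : z = gdom x by rewrite c (gdom_id zO).
  by rewrite xz gcomp_dom.
- move=> [x a] [/= e _]; apply/range_objects_inclP => /=.
  by rewrite t in e.
move=> [x a] p [[e b] [/range_objects_inclP /= eO [re] _ ->]].
apply/range_objects_inclP; rewrite /= !t.
(* Having the same range as [x], the object [e] is [r(x)], so the first component of the conjugate
   is [x^-1 r(x) x = d(x)]. *)
have ex : e = grng x by rewrite -re gdom_id.
by rewrite ex -gdom_inv gcomp_dom gcompVg; apply: objects_dom.
Qed.

Lemma trivial_of_normal_in :
  normal_in (@objects_incl X G w) -> trivial_action w.
Proof.
case=> _ iH [_ nH]; apply/trivial_actionP => a x.
(* This rests on the homomorphism clause of [normal_in]: normality of the set alone would still
   allow [w b] to permute objects. *)
have fix_obj b (e : X) : objects X e -> w b e = e.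
  move=> eO; pose e' : object_groupoid X := exist _ e eO.
  have c : @composable (dprod (object_groupoid X) G) (e', b) (e', 1%g) by [].
  have [/sdprod_composableP /= r _] := iH _ _ c.
  by rewrite -(hom_rng (aut_hom _)) eO (gdom_id eO) in r.
have wr : grng (w a x) = grng x.
  by rewrite -(hom_rng (aut_hom _)) fix_obj //; apply: objects_rng.
apply: (eq_of_inv_comp_object wr).
pose y : sdprod w := (x, 1%g); pose h : sdprod w := (grng x, a).
have : gconj (range (@objects_incl X G w)) y (gcomp (gcomp (ginv y) h) y).
  exists h; split=> //=.
  - exact/range_objects_inclP/objects_rng.
  - by rewrite grngR.
  (* The domain of [h] has first component [w_{a^-1}(r(x))], which is [r(x)] since objects are
     fixed. *)
  - by rewrite gdomR fix_obj //; apply: objects_rng.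
move=> /nH /range_objects_inclP /=.
(* The conjugate has first component [x^-1 r(x) w_a(x)], where [r(x) = d(x^-1)] is absorbed. *)
by rewrite !invg1 !act_one mul1g -(gdom_inv x) gcomp_dom.
Qed.

End Semidirect.

Theorem theorem3p8 (X : groupoid) (X_nonempty : inhabited X) (G : groupType)
    (w : {multiplicative G -> Aut X}) :
  let identity : dprod X G -> sdprod w := fun p => p in
  [/\ groupoid_hom identity <-> trivial_action w,
      trivial_action w <-> normal_in (@objects_incl X G w)
    & groupoid_hom identity -> groupoid_iso identity].
Proof.
move=> identity; split.
- exact: hom_identityP.
- by split; [apply: normal_in_of_trivial | apply: trivial_of_normal_in].
- move=> idH; split=> //; exists (fun p => p); split=> //.
  exact/hom_identity_inv/hom_identityP.
Qed.
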